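(* For any $m\in\mathbb N^*=\mathbb N\cup\{\infty\}$ and $f,g\in\mathcal K$, the operators $l^{(m)*}(f)$ and $l^{(m)}(f)$ (defined on the finite particle domain $\Gamma_0(\mathcal H)$) have unique bounded extensions to $\Gamma(\mathcal H)$, are adjoints of each other, and satisfy the relation $$l^{(m)}(g)\,l^{(m)*}(f)=\langle g,f\rangle P^{(m)} .$$
   Context: $\mathcal K=L^2(\mathbb R^+)$, $\mathcal G$ is a separable Hilbert space with fixed orthonormal basis $(e_k)_{k\in\mathbb N}$, $\mathbb N=\{1,2,\dots\}$, $\mathcal H=\mathcal K\otimes\mathcal G$. $\Gamma(\mathcal H)=\mathbb C\Omega\oplus\bigoplus_{n\ge1}\mathcal H^{\circ n}$ is the symmetric Fock space with $u_1\circ\cdots\circ u_n=\frac1{n!}\sum_{\pi\in S_n}u_{\pi(1)}\otimes\cdots\otimes u_{\pi(n)}$, $\|\Omega\|=1$, $\langle u_1\circ\cdots\circ u_n,v_1\circ\cdots\circ v_m\rangle=\delta_{n,m}\frac1{n!}\sum_{\pi\in S_n}\prod_i\langle u_i,v_{\pi(i)}\rangle$ (scalar products conjugate-linear in the first argument). The finite particle domain $\Gamma_0(\mathcal H)$ is the linear span of $\Omega$ and the vectors $(f_1\otimes e_{k_1})\circ\cdots\circ(f_n\otimes e_{k_n})$, $f_i\in\mathcal K$, $k_1\le\dots\le k_n$, $n\in\mathbb N$. Boson operators: $a^*(u)\Omega=u$, $a^*(u)\,v_1\circ\cdots\circ v_n=\sqrt{n+1}\,u\circ v_1\circ\cdots\circ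 v_n$, $a(u)\Omega=0$, $a(u)\,v_1\circ\cdots\circ v_n=\frac1{\sqrt n}\sum_j\langle u,v_j\rangle v_1\circ\cdots\breve v_j\cdots\circ v_n$ ($\breve v_j$ omitted). For $r\in\mathbb N$, $P^{(r)}$ is the projection of $\Gamma(\mathcal H)$ onto $\Gamma(\mathcal H^{(r)})$, where $\mathcal H^{(r)}$ is spanned by $f\otimes e_k$, $f\in\mathcal K$, $1\le k\le r-1$ ($\mathcal H^{(1)}=\{0\}$, so $P^{(1)}$ projects onto $\mathbb C\Omega$); $P^{(0)}=0$ and $P^{(\infty)}=I$. Put $a^{(r)*}(f\otimes e_k)=a^*(f\otimes e_k)P^{(r)}$, $a^{(r)}(f\otimes e_k)=P^{(r)}a(f\otimes e_k)$, and define the extended $m$-free creation and annihilation operators $$l^{(m)*}(f)=\sum_{k=1}^m\big(a^{(k)*}(f\otimes e_k)-a^{(k-1)*}(f\otimes e_k)\big),\qquad l^{(m)}(f)=\sum_{k=1}^m\big(a^{(k)}(f\otimes e_k)-a^{(k-1)}(f\otimes e_k)\big);$$ for $m=\infty$ the series converge strongly on $\Gamma_0(\mathcal H)$ (only finitely many terms act non-trivially on each vector). *)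

(* Defs.v *)
From HB Require Import structures.
From mathcomp Require Import all_boot all_order all_algebra.
From mathcomp Require Import fingroup perm.
From mathcomp Require Import all_classical all_reals all_analysis.
From mathcomp Require Import sesquilinear complex.

Set Implicit Arguments.
Unset Strict Implicit.
Unset Printing Implicit Defensive.

Import Order.TTheory GRing.Theory Num.Theory.
Import numFieldNormedType.Exports.

Local Open Scope classical_set_scope.
Local Open Scope ring_scope.

(* Complex Hilbert spaces: complete normed modules over R[i] whose norm comes *)
(* from an inner product. The forms of sesquilinear.v are linear in the FIRST *)
(* argument, so [hform] is the transpose of the inner product [dotp] below.   *)
HB.mixin Record CompleteNormedModule_isHilbert (R : realType) V
    of CompleteNormedModule R[i] V := {
  hform : {dot V for (@Num.conj R[i])} ;
  norm_hform : forall u : V, `|u| ^+ 2 = hform u u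
}.

#[short(type="hilbertType")]
HB.structure Definition Hilbert (R : realType) :=
  {V of CompleteNormedModule R[i] V & CompleteNormedModule_isHilbert R V}.

(* Conjugate-linear in the first argument, linear in the second. *)
Definition dotp (R : realType) (V : hilbertType R) (u v : V) : R[i] :=
  hform v u.

Section LinearHulls.
Context (R : realType) (V : hilbertType R).

Definition lspan (S : set V) : set V :=
  [set x | exists n (c : 'I_n -> R[i]) (s : 'I_n -> V),
     (forall i, S (s i)) /\ x = \sum_(i < n) c i *: s i].

Definition cspan (S : set V) : set V := closure (lspan S).

(* The linear map b t |-> b' t on the linear span of the family b; the value  *)
(* is 0 off this span.                                                        *)
Definition linear_extension (T : Type) (b b' : T -> V) (x : V) : V :=
  xget 0 [set y | exists n (c : 'I_n -> R[i]) (t : 'I_n -> T),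
     x = \sum_(i < n) c i *: b (t i) /\ y = \sum_(i < n) c i *: b' (t i)].

(* The orthogonal projection onto the closed linear subspace S. *)
Definition orth_proj (S : set V) (x : V) : V :=
  xget 0 [set y | S y /\ forall z, S z -> dotp z (x - y) = 0].

Definition bounded_extension (D : set V) (T A : V -> V) : Prop :=
  [/\ linear A,
      exists M : R[i], forall x, `|A x| <= M * `|x| &
      forall x, D x -> A x = T x].

Definition adjoint_of (A B : V -> V) : Prop :=
  forall x y, dotp (A x) y = dotp x (B y).

(* Indices start at 1; the value e 0 plays no role. *)
Definition orthonormal_basis (e : nat -> V) : Prop :=
  (forall j k, (0 < j)%N -> (0 < k)%N -> dotp (e j) (e k) = (j == k)%:R) /\
  cspan (e @` [set k | (0 < k)%N]) = setT.

End LinearHulls.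

Section L2.
Context (R : realType).

Definition lebesgue_Rplus :=
  mrestr (@lebesgue_measure R)
    (measurable_itv `[0, +oo[ : measurable (`[0, +oo[%classic : set R)).

(* Complex-valued L^2(R^+): the real and imaginary parts are elements of the  *)
(* library's real L^2 space, i.e. classes modulo equality almost everywhere.  *)
Record L2C := MkL2C {
  L2re : LspaceType2 lebesgue_Rplus ;
  L2im : LspaceType2 lebesgue_Rplus }.

(* Integral of (conjugate of f) times g. *)
Definition L2dot (f g : L2C) : R[i] :=
  Complex
    (\int[lebesgue_Rplus]_x (L2re f x * L2re g x + L2im f x * L2im g x))
    (\int[lebesgue_Rplus]_x (L2re f x * L2im g x - L2im f x * L2re g x)).

End L2.

(* A Hilbert space H with a map t realizes L^2(R^+) (x) G when the simple     *)
(* tensors t f x have the inner products below and are total in H. This       *)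
(* determines (H, t) up to a unique unitary, and bilinearity of t follows.    *)
Definition is_tensor_product (R : realType) (G H : hilbertType R)
    (t : L2C R -> G -> H) : Prop :=
  (forall f g x y, dotp (t f x) (t g y) = L2dot f g * dotp x y) /\
  cspan [set u | exists f x, u = t f x] = setT.

(* A Hilbert space F with a map sp realizes the symmetric Fock space over H,  *)
(* sp [:: u_1; ..; u_n] being u_1 o .. o u_n and sp [::] the vacuum, when     *)
(* these vectors have the inner products below and are total in F. Symmetry   *)
(* and multilinearity of sp follow from the inner products.                   *)
Definition is_symmetric_Fock (R : realType) (H F : hilbertType R)
    (sp : seq H -> F) : Prop :=
  (forall u v : seq H, dotp (sp u) (sp v) =
     if size u == size v then
       ((size u)`!%:R)^-1 *
         \sum_(s : 'S_(size u)) \prod_(i < size u) dotp u`_i v`_(s i)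
     else 0) /\
  cspan (range sp) = setT.

Section BosonOperators.
Context (R : realType) (H F : hilbertType R) (sp : seq H -> F).

Definition creation (u : H) : F -> F :=
  linear_extension sp
    (fun v => sqrtC (size v).+1%:R *: sp (u :: v)).

(* On the vacuum the sum is empty, hence a(u) kills it. *)
Definition annihilation (u : H) : F -> F :=
  linear_extension sp
    (fun v => (sqrtC (size v)%:R)^-1 *:
       \sum_(j < size v) dotp u v`_j *: sp (take j v ++ drop j.+1 v)).

End BosonOperators.

Section ExtendedFree.
Context (R : realType) (G H F : hilbertType R).
Context (e : nat -> G) (t : L2C R -> G -> H) (sp : seq H -> F).

Definition finite_particle : set F :=
  lspan [set x | exists s : seq (L2C R * nat),
     [/\ all (fun p => 0 < p.2)%N s,
         sorted leq [seq p.2 | p <- s] &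
         x = sp [seq t p.1 (e p.2) | p <- s]]].

Definition one_particle (r : nat) : set H :=
  cspan [set u | exists f k, (0 < k < r)%N /\ u = t f (e k)].

(* The Fock space over a closed subspace S of H, inside the one over H. *)
Definition sub_Fock (S : set H) : set F :=
  cspan (sp @` [set us : seq H | forall u, u \in us -> S u]).

(* None stands for infinity. *)
Definition proj_level (r : option nat) : F -> F :=
  match r with
  | None => fun x => x
  | Some 0 => fun=> 0
  | Some r => orth_proj (sub_Fock (one_particle r))
  end.

Definition creation_level (r : nat) (u : H) (x : F) : F :=
  creation sp u (proj_level (Some r) x).

Definition annihilation_level (r : nat) (u : H) (x : F) : F :=
  proj_level (Some r) (annihilation sp u x).

Definition free_creation (m : option nat) (f : L2C R) (x : F) : F :=
  let partial_sum n := \sum_(1 <= k < n.+1)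
    (creation_level k (t f (e k)) x - creation_level k.-1 (t f (e k)) x) in
  match m with
  | Some n => partial_sum n
  | None => limn partial_sum
  end.

Definition free_annihilation (m : option nat) (f : L2C R) (x : F) : F :=
  let partial_sum n := \sum_(1 <= k < n.+1)
    (annihilation_level k (t f (e k)) x
     - annihilation_level k.-1 (t f (e k)) x) in
  match m with
  | Some n => partial_sum n
  | None => limn partial_sum
  end.

End ExtendedFree.

(* Main.v *)
Require Import Defs.
From HB Require Import structures.
From mathcomp Require Import all_boot all_order all_algebra.
From mathcomp Require Import fingroup perm.
From mathcomp Require Import all_classical all_reals all_analysis.
From mathcomp Require Import sesquilinear complex.
From mathcomp Require Import ring.

Set Implicit Arguments.
Unset Strict Implicit.
Unset Printing Implicit Defensive.

Import Order.TTheory GRing.Theory Num.Theory.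
Import numFieldNormedType.Exports.

Local Open Scope classical_set_scope.
Local Open Scope ring_scope.

(** Write E(s) for the product vector of a list s of letters (f, k), standing for
    f (x) e_k, and call the largest index k occurring in s its level (0 for the
    vacuum). These vectors span the finite particle domain D. Product vectors
    of different levels are orthogonal, and P^(r) keeps those of level below r
    and kills the others, so P^(k) - P^(k-1) selects level k - 1. Hence, on a
    vector of level L, the sum defining l^(m)*(f) collapses to the single term
    with k = L + 1, when L < m:

      l^(m)*(f) E(s) = sqrt(n + 1) (f (x) e_{L+1}) o E(s),

    a new letter whose index is larger than all others ([free_creation_on]).
    Likewise l^(m)(g) can only remove a letter whose index is one above the
    level of the remaining letters ([free_annihilation_on]). After l^(m)*(f),
    that letter is the one just created, and
    l^(m)(g) l^(m)*(f) = <g, f> P^(m) on D ([free_relation_on]). No factor n + 1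
    is left, unlike for boson operators, as the new letter is orthogonal to
    all the old ones.

    The inner products of Fock space are permanents, and their expansion along
    a row says that creation and annihilation are formally adjoint on product
    vectors. Since those vectors are total, this makes both operators well
    defined on their span ([linear_extension_linear]), and with the
    orthogonality of levels it makes l^(m)*(f) and l^(m)(f) adjoint on D
    ([free_adjoint_on]). Boundedness is then a consequence of the relation:
    |l^(m)*(f) x|^2 = <x, l^(m)(f) l^(m)*(f) x> = |f|^2 <x, P^(m) x>, which is at
    most |f|^2 |x|^2, and the adjoint has the same bound.

    What remains is continuity. The domain D is dense ([kets_dense]), so bounded
    operators on D extend uniquely ([bounded_extension_exists] and
    [bounded_extension_eq]), and both adjointness and the relation pass from D
    to the whole space. The relation involves P^(m) off D, where its existence
    and boundedness are obtained from the extension of its restriction to D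
    ([proj_level_bounded]). *)

(** * Inner products and linear hulls *)

Section InnerProduct.
Context (R : realType) (V : hilbertType R).
Implicit Types (u v w x y z : V) (a : R[i]) (S D : set V).

Lemma dotpDl u v w : dotp (u + v) w = dotp u w + dotp v w.
Proof. by rewrite /dotp linearDr. Qed.

Lemma dotpDr u v w : dotp u (v + w) = dotp u v + dotp u w.
Proof. by rewrite /dotp linearDl. Qed.

Lemma dotpZr a u v : dotp u (a *: v) = a * dotp u v.
Proof. by rewrite /dotp linearZl_LR. Qed.

Lemma dotpZl a u v : dotp (a *: u) v = a^* * dotp u v.
Proof. by rewrite /dotp linearZr_LR. Qed.

Lemma dotpNl u v : dotp (- u) v = - dotp u v.
Proof. by rewrite /dotp linearNr. Qed.

Lemma dotpNr u v : dotp u (- v) = - dotp u v.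
Proof. by rewrite /dotp linearNl. Qed.

Lemma dotpBl u v w : dotp (u - v) w = dotp u w - dotp v w.
Proof. by rewrite dotpDl dotpNl. Qed.

Lemma dotpBr u v w : dotp u (v - w) = dotp u v - dotp u w.
Proof. by rewrite dotpDr dotpNr. Qed.

Lemma dotp0l u : dotp 0 u = 0.
Proof. by rewrite /dotp linear0r. Qed.

Lemma dotp0r u : dotp u 0 = 0.
Proof. by rewrite /dotp linear0l. Qed.

Lemma dotp_sumr I (r : seq I) (P : pred I) u (f : I -> V) :
  dotp u (\sum_(i <- r | P i) f i) = \sum_(i <- r | P i) dotp u (f i).
Proof. exact: (big_morph (dotp u) (dotpDr u) (dotp0r u)). Qed.

Lemma dotp_suml I (r : seq I) (P : pred I) u (f : I -> V) :
  dotp (\sum_(i <- r | P i) f i) u = \sum_(i <- r | P i) dotp (f i) u.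
Proof.
by apply: (big_morph (fun v => dotp v u)) => [v w|]; rewrite ?dotpDl ?dotp0l.
Qed.

Lemma dotpC u v : dotp u v = (dotp v u)^*.
Proof. by rewrite /dotp [LHS]hermC expr0 mul1r. Qed.

Lemma dotp_eq0C u v : dotp u v = 0 -> dotp v u = 0.
Proof. by rewrite dotpC => /eqP; rewrite conjC_eq0 => /eqP. Qed.

Lemma dotpp u : dotp u u = `|u| ^+ 2.
Proof. by rewrite norm_hform. Qed.

Lemma dotpp_eq0 u : dotp u u = 0 -> u = 0.
Proof. by rewrite dotpp => /eqP; rewrite sqrf_eq0 normr_eq0 => /eqP. Qed.

Lemma le_norm_dotp u v : `|dotp u v| <= `|u| * `|v|.
Proof.
have [->|v0] := eqVneq v 0; first by rewrite dotp0r !normr0 mulr0.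
have np : 0 < `|v| ^+ 2 by rewrite exprn_gt0 // normr_gt0.
rewrite -(@ler_pXn2r _ 2) ?nnegrE ?mulr_ge0 // exprMn -(ler_pM2l np).
rewrite -subr_ge0.
(* The vector below is |v|^2 times the component of u orthogonal to v. *)
suff <- : `|(`|v| ^+ 2) *: u - dotp v u *: v| ^+ 2 =
    `|v| ^+ 2 * (`|u| ^+ 2 * `|v| ^+ 2) - `|v| ^+ 2 * `|dotp u v| ^+ 2.
  by rewrite exprn_ge0.
have vr : (`|v| ^+ 2)^* = `|v| ^+ 2 by rewrite conj_Creal // ger0_real // ltW.
have -> : `|dotp u v| ^+ 2 = dotp u v * dotp v u.
  by rewrite normCK [dotp v u]dotpC.
rewrite -[LHS]dotpp dotpBl !dotpBr !dotpZl !dotpZr vr.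
rewrite -[(dotp v u)^*]dotpC !dotpp.
by rewrite [dotp v u * dotp u v]mulrC !mulrA; ring.
Qed.

(** Used when the square of a norm equals an inner product in which the same
    vector occurs once, so that Cauchy-Schwarz leaves one factor to cancel:
    this bounds projections, and adjoints of bounded operators. *)
Lemma norm_le_of_sqr (x M : R[i]) :
  0 <= x -> 0 <= M -> x ^+ 2 <= M * x -> x <= M.
Proof.
move=> x0 M0; have [->//|xn0] := eqVneq x 0.
have xp : 0 < x by rewrite lt_def xn0.
by rewrite expr2 ler_pM2r.
Qed.

End InnerProduct.

Section LinearHull.
Context (R : realType) (V : hilbertType R).
Implicit Types (u v w x y z : V) (a : R[i]) (S D : set V).

Definition submodule D := D 0 /\ forall a x y, D x -> D y -> D (a *: x + y).

Lemma submodule_sum D : submodule D -> forall I (r : seq I) (P : pred I)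
  (f : I -> V), (forall i, P i -> D (f i)) -> D (\sum_(i <- r | P i) f i).
Proof.
move=> [D0 Dl] I r P f Df; elim/big_ind: _ => // x y Dx Dy.
by rewrite -[x]scale1r; exact: Dl.
Qed.

Lemma submoduleZ D a x : submodule D -> D x -> D (a *: x).
Proof. by move=> [D0 Dl] Dx; rewrite -[_ *: _]addr0; exact: Dl. Qed.

Lemma submoduleB D x y : submodule D -> D x -> D y -> D (x - y).
Proof.
by move=> [D0 Dl] Dx Dy; rewrite addrC -scaleN1r; exact: Dl.
Qed.

Lemma lspan_ind S (P : V -> Prop) :
  P 0 -> (forall a x y, S x -> P y -> P (a *: x + y)) ->
  forall x, lspan S x -> P x.
Proof.
move=> P0 PD x [n [c [s [Ss ->]]]].
have : forall r : seq 'I_n, P (\sum_(i <- r) c i *: s i).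
  elim=> [|i r IH]; first by rewrite big_nil.
  by rewrite big_cons; exact: PD.
exact.
Qed.

Lemma lspan_min S D : submodule D -> S `<=` D -> lspan S `<=` D.
Proof.
move=> sD SD x [n [c [s [Ss ->]]]].
by apply: submodule_sum => // i _; apply: submoduleZ => //; exact: SD.
Qed.

Lemma sub_lspan S : S `<=` lspan S.
Proof.
move=> x Sx; exists 1%N, (fun=> 1), (fun=> x); split=> //.
by rewrite big_ord1 scale1r.
Qed.

Lemma lspan_submodule S : submodule (lspan S).
Proof.
split.
  by exists 0%N, (fun=> 0), (fun=> 0); split; [case|rewrite big_ord0].
move=> a x y [n [c [s [Ss ->]]]] [p [d [r [Sr ->]]]].
exists (n + p)%N,
  (fun i => match fintype.split i with inl j => a * c j | inr j => d j end),
  (fun i => match fintype.split i with inl j => s j | inr j => r j end).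
split; first by move=> i; case: fintype.split.
rewrite big_split_ord /= scaler_sumr; congr (_ + _); apply: eq_bigr => i _.
  by rewrite (unsplitK (inl i : 'I_n + 'I_p)) scalerA.
by rewrite (unsplitK (inr i : 'I_n + 'I_p)).
Qed.

Lemma closure_normP D x :
  closure D x <-> forall eps : R[i], 0 < eps -> exists2 y, D y & `|x - y| < eps.
Proof.
split=> [cx eps e0|H B /nbhs_ballP[eps e0 Be]].
  by have [y [Dy]] := cx _ (nbhsx_ballx x eps e0); rewrite -ball_normE; exists y.
have [y Dy xy] := H _ e0; exists y; split=> //; apply: Be.
by rewrite -ball_normE.
Qed.

Lemma norm_comb_lt a (eps : R[i]) u u' v v' :
  `|u - u'| < eps / 2 / (`|a| + 1) -> `|v - v'| < eps / 2 ->
  `|a *: u + v - (a *: u' + v')| < eps.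
Proof.
move=> uu vv; have n0 : 0 < `|a| + 1 by rewrite ltr_wpDl.
rewrite opprD addrACA -scalerBr [ltRHS](splitr eps).
apply: le_lt_trans (ler_normD _ _) _; rewrite normrZ ler_ltD //.
have : (`|a| + 1) * `|u - u'| <= eps / 2 by rewrite mulrC -ler_pdivlMr // ltW.
by apply: le_trans; rewrite ler_wpM2r // lerDl.
Qed.

Lemma closure_submodule D : submodule D -> submodule (closure D).
Proof.
move=> [D0 DD]; split; first exact: subset_closure.
move=> a x y /closure_normP cx /closure_normP cy; apply/closure_normP => eps e0.
have n0 : 0 < `|a| + 1 by rewrite ltr_wpDl.
have d0 : 0 < eps / 2 / (`|a| + 1) by rewrite !divr_gt0.
have [x' Dx xx] := cx _ d0; have [y' Dy yy] := cy _ (divr_gt0 e0 (ltr0Sn _ 1)).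
by exists (a *: x' + y'); [exact: DD | exact: norm_comb_lt].
Qed.

Lemma cspan_submodule S : submodule (cspan S).
Proof. exact/closure_submodule/lspan_submodule. Qed.

Lemma sub_cspan S : S `<=` cspan S.
Proof. by move=> x Sx; apply/subset_closure/sub_lspan. Qed.

Lemma cspan_min S D : submodule D -> closed D -> S `<=` D -> cspan S `<=` D.
Proof.
move=> sD cD SD x Sx; apply: cD; apply: closureS Sx; exact: lspan_min.
Qed.

End LinearHull.

(** * Bounded operators and density *)

Section Density.
Context (R : realType).

(** In the complex scalars a bound [M] need not be comparable with 0; this
    replaces it by a nonnegative one. *)
Lemma le_normM_of_le (b M c : R[i]) :
  0 <= b -> 0 <= c -> b <= M * c -> b <= `|M| * c.
Proof.
move=> b0 c0 bM; have M0 := le_trans b0 bM.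
by rewrite -[X in _ <= _ * X](ger0_norm c0) -normrM ger0_norm.
Qed.

(** Additivity is the common part of linear and conjugate-linear maps, so this
    one lemma handles either argument of an inner product. *)
Lemma bounded_vanish (V : hilbertType R) (W : normedModType R[i])
    (D : set V) (h : V -> W) (M : R[i]) :
  (forall x y, h (x - y) = h x - h y) -> (forall x, `|h x| <= M * `|x|) ->
  (forall x, D x -> h x = 0) -> forall x, closure D x -> h x = 0.
Proof.
move=> hB hM hD x /closure_normP cx.
have h0 : forall eps : R[i], 0 < eps -> `|h x| <= eps.
  move=> eps e0; have n0 : 0 < `|M| + 1 by rewrite ltr_wpDl.
  have [y Dy xy] := cx _ (divr_gt0 e0 n0).
  have -> : h x = h (x - y) by rewrite hB (hD y) // subr0.
  have : (`|M| + 1) * `|x - y| <= eps by rewrite mulrC -ler_pdivlMr // ltW.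
  apply: le_trans.
  apply: le_trans (le_normM_of_le _ _ (hM _)) _ => //.
  by rewrite ler_wpM2r // lerDl.
apply/eqP; rewrite -normr_le0; apply/negPn/negP => hn.
have hp : 0 < `|h x|.
  by rewrite lt_def normr_ge0 andbT; apply: contra hn => /eqP ->.
have := h0 _ (divr_gt0 hp (ltr0Sn _ 1)).
by rewrite ler_pdivlMr // ger_pMr // (ler_nat _ 2 1).
Qed.

Lemma eq_of_dotp_total (V : hilbertType R) (S : set V) (x y : V) :
  cspan S = setT -> (forall z, S z -> dotp x z = dotp y z) -> x = y.
Proof.
move=> cS xy; apply/eqP; rewrite -subr_eq0; apply/eqP/dotpp_eq0.
apply: (@bounded_vanish V R[i]^o (lspan S) (dotp (x - y)) (`|x - y|)).
- by move=> u v; rewrite dotpBr.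
- by move=> u; exact: le_norm_dotp.
- apply: lspan_ind; first by rewrite dotp0r.
  by move=> a u v Su xyv; rewrite dotpDr dotpZr dotpBl xy // subrr mulr0 add0r.
- by rewrite -/(cspan S) cS.
Qed.

End Density.

Section BoundedMaps.
Context (R : realType) (V W : hilbertType R).
Implicit Types (T : V -> W).

Lemma linear_mapB T : linear T -> forall x y, T (x - y) = T x - T y.
Proof. by move=> lT x y; rewrite addrC -scaleN1r lT scaleN1r addrC. Qed.

Lemma linear_map0 T : linear T -> T 0 = 0.
Proof. by move=> lT; rewrite -[0]subr0 linear_mapB // subrr. Qed.

Lemma submodule_preimage T (C : set W) : linear T -> submodule C ->
  submodule [set x | C (T x)].
Proof.
move=> lT [C0 CD]; split=> /=; first by rewrite linear_map0.
by move=> a x y Cx Cy; rewrite lT; exact: CD.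
Qed.

Lemma closed_preimage T (C : set W) (M : R[i]) : linear T -> 0 <= M ->
  (forall x, `|T x| <= M * `|x|) -> closed C -> closed [set x | C (T x)].
Proof.
move=> lT M0 TM cC x /closure_normP cx; apply: cC.
apply/closure_normP => eps e0; have M1 : 0 < M + 1 by rewrite ltr_wpDl.
have [z Dz xz] := cx _ (divr_gt0 e0 M1); exists (T z) => //.
rewrite -(linear_mapB lT); apply: le_lt_trans (TM _) _.
move: xz; rewrite ltr_pdivlMr // mulrC; apply: le_lt_trans.
by rewrite ler_wpM2r // lerDl.
Qed.

Lemma total_preimage T (S : set V) (C : set W) (M : R[i]) : cspan S = setT ->
  linear T -> 0 <= M -> (forall x, `|T x| <= M * `|x|) ->
  submodule C -> closed C -> (forall x, S x -> C (T x)) -> forall x, C (T x).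
Proof.
move=> cS lT M0 TM sC cC SC x.
have : cspan S x by rewrite cS.
apply: (cspan_min (D := [set x | C (T x)])) => //.
  exact: submodule_preimage.
exact: (closed_preimage lT M0 TM).
Qed.

End BoundedMaps.

Section Extension.
Context (R : realType) (V : hilbertType R).
Implicit Types (D : set V) (T A B : V -> V).

Definition linear_on D T :=
  forall (a : R[i]) x y, D x -> D y -> T (a *: x + y) = a *: T x + T y.

Lemma linear_on0 D T : submodule D -> linear_on D T -> T 0 = 0.
Proof.
move=> [D0 _] lT; have /eqP := lT 1 0 0 D0 D0.
by rewrite scaler0 addr0 scale1r -subr_eq0 opprD addNKr oppr_eq0 => /eqP.
Qed.

Lemma linear_onB D T x y : submodule D -> linear_on D T -> D x -> D y ->
  T (x - y) = T x - T y.
Proof. by move=> sD lT Dx Dy; rewrite addrC -scaleN1r lT // scaleN1r addrC. Qed.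

Lemma linear_onZ D T a x : submodule D -> linear_on D T -> D x ->
  T (a *: x) = a *: T x.
Proof.
move=> sD lT Dx; have T0 := linear_on0 sD lT; case: sD => D0 _.
by rewrite -[a *: x]addr0 lT // T0 addr0.
Qed.

Lemma linear_on_sum D T n (c : 'I_n -> R[i]) (x : 'I_n -> V) : submodule D ->
  linear_on D T -> (forall i, D (x i)) ->
  T (\sum_(i < n) c i *: x i) = \sum_(i < n) c i *: T (x i).
Proof.
move=> sD lT Dx.
suff E (r : seq 'I_n) : D (\sum_(i <- r) c i *: x i) /\
    T (\sum_(i <- r) c i *: x i) = \sum_(i <- r) c i *: T (x i).
  by case: (E (index_enum _)).
elim: r => [|i r [Dr E]]; first by rewrite !big_nil (linear_on0 sD); case: sD.
by rewrite !big_cons lT // E; split=> //; case: sD => _; apply.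
Qed.

Lemma linear_on_eq (S : set V) T A : linear_on (lspan S) T ->
  linear_on (lspan S) A -> (forall x, S x -> T x = A x) ->
  forall x, lspan S x -> T x = A x.
Proof.
move=> lT lA TA x Sx.
have sS := lspan_submodule S.
suff : lspan S x /\ T x = A x by case.
move: x Sx; apply: lspan_ind.
  by split; [case: sS | rewrite !(linear_on0 sS)].
move=> a x y Sx [Sy E]; have Lx := sub_lspan Sx.
by split; [case: sS => _; apply | rewrite lT // lA // E TA].
Qed.

Lemma linear_on_image (S D : set V) T : submodule D -> linear_on (lspan S) T ->
  (forall x, S x -> D (T x)) -> forall x, lspan S x -> D (T x).
Proof.
move=> sD lT SD x Sx; have sS := lspan_submodule S.
suff : lspan S x /\ D (T x) by case.
move: x Sx; apply: lspan_ind.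
  by split; [case: sS | rewrite (linear_on0 sS) //; case: sD].
move=> a x y Sx [Sy E]; have Lx := sub_lspan Sx.
split; first by case: sS => _; apply.
by rewrite lT //; case: sD => _; apply => //; exact: SD.
Qed.

Lemma bounded_extension_eq D T A A' : submodule D -> closure D = setT ->
  bounded_extension D T A -> bounded_extension D T A' -> A = A'.
Proof.
move=> sD cD [lA [M hM] AT] [lA' [M' hM'] AT']; apply/funext => x.
apply/eqP; rewrite -subr_eq0; apply/eqP.
apply: (@bounded_vanish _ V V D (fun x => A x - A' x) (`|M| + `|M'|)).
- by move=> u v; rewrite (linear_mapB lA) (linear_mapB lA') !opprD !opprK addrACA.
- move=> u; rewrite mulrDl; apply: le_trans (ler_normB _ _) _.
  by apply: lerD; apply: le_normM_of_le.
- by move=> u Du; rewrite AT // AT' // subrr.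
- by rewrite cD.
Qed.

(** Extension by continuity. The value at [x] is the limit of [T] along [D]
    near [x]: the images form a Cauchy filter because [T] is Lipschitz on [D]. *)
Lemma bounded_extension_exists D T (M : R[i]) : submodule D -> closure D = setT ->
  linear_on D T -> 0 <= M -> (forall x, D x -> `|T x| <= M * `|x|) ->
  exists A, bounded_extension D T A /\ forall x, `|A x| <= M * `|x|.
Proof.
move=> sD cD lT M0 TM.
pose lim_at x y := forall eps : R[i], 0 < eps ->
  exists2 z, D z & `|x - z| < eps /\ `|y - T z| < eps.
have M1 : 0 < M + 1 by rewrite ltr_wpDl.
(* Points of [D] within eps / 2 / (M + 1) of [x] have images within [eps] of
   each other; the summand 1 keeps the divisor positive when [M] is 0. *)
have lim_ex x : exists y, lim_at x y.
  have FF : ProperFilter (within D (nbhs x)).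
    by apply: within_nbhs_proper; rewrite cD.
  have /cauchy_cvg /cvg_ex [y Ty] : cauchy (T @ within D (nbhs x)).
    apply: cauchy_exP => eps e0.
    have [z Dz xz] : exists2 z, D z & `|x - z| < eps / 2 / (M + 1).
      have /closure_normP cx : closure D x by rewrite cD.
      by apply: cx; rewrite !divr_gt0.
    exists (T z); rewrite /fmap /within /=.
    have := nbhsx_ballx x _ (divr_gt0 (divr_gt0 e0 (ltr0Sn _ 1)) M1).
    apply: filterS => w; rewrite -!ball_normE /= => xw Dw.
    rewrite -(linear_onB sD lT) //.
    apply: le_lt_trans (TM _ (submoduleB sD Dz Dw)) _.
    have zw : `|z - w| < eps / (M + 1).
      rewrite (splitr eps) mulrDl.
      have -> : z - w = (x - w) - (x - z) by rewrite opprB [RHS]addrC addrA subrK.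
      apply: le_lt_trans (ler_normB _ _) _; exact: ltrD.
    move: zw; rewrite ltr_pdivlMr // mulrC; apply: le_lt_trans.
    by rewrite ler_wpM2r // lerDl.
  exists y => eps e0.
  move/cvgrPdist_lt: Ty => /(_ _ e0); rewrite /= near_withinE => Ty.
  have [z [Dz [zz1 zz2]]] :
      D `&` [set z | `|x - z| < eps /\ `|y - T z| < eps] !=set0.
    have cx : closure D x by rewrite cD.
    have /cx : nbhs x [set z | `|x - z| < eps /\ (D z -> `|y - T z| < eps)].
      apply: filterI; last exact: Ty.
      by have := nbhsx_ballx x _ e0; rewrite -ball_normE.
    by move=> [z [Dz [? /(_ Dz) ?]]]; exists z.
  by exists z.
have lim_lin a x y x' y' : lim_at x x' -> lim_at y y' ->
    lim_at (a *: x + y) (a *: x' + y').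
  move=> lx ly eps e0; have n0 : 0 < `|a| + 1 by rewrite ltr_wpDl.
  have d0 : 0 < eps / 2 / (`|a| + 1) by rewrite !divr_gt0.
  have [z Dz [xz xz']] := lx _ d0.
  have [w Dw [yw yw']] := ly _ (divr_gt0 e0 (ltr0Sn _ 1)).
  exists (a *: z + w); first by case: sD => _; apply.
  by rewrite lT //; split; exact: norm_comb_lt.
have lim_bd x y : lim_at x y -> `|y| <= M * `|x|.
  move=> l; apply/ler_addgt0Pr => eps e0.
  have [z Dz [xz yz]] := l _ (divr_gt0 e0 M1).
  have -> : y = (y - T z) + T z by rewrite subrK.
  apply: le_trans (ler_normD _ _) _.
  have zx : `|z| <= `|x| + `|x - z|.
    by rewrite -[X in `|X| <= _](subKr x); exact: ler_normB.
  apply: le_trans (lerD (ltW yz) (TM _ Dz)) _.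
  have {}zx := le_trans zx (lerD (lexx _) (ltW xz)).
  apply: le_trans (lerD (lexx _) (ler_wpM2l M0 zx)) _.
  rewrite mulrDr addrCA lerD2l -[X in X + _]mul1r -mulrDl addrC mulrC divfK //.
  by rewrite gt_eqF.
have [A hA] := choice lim_ex.
have uniq x y : lim_at x y -> A x = y.
  move=> ly; apply/eqP; rewrite -subr_eq0 -normr_le0.
  have := lim_bd _ _ (lim_lin (-1) x x y (A x) ly (hA x)).
  by rewrite !scaleN1r addNr normr0 mulr0 addrC.
have AM x : `|A x| <= M * `|x| by apply: lim_bd.
exists A; split=> //; split.
- by move=> a x y; apply: uniq; apply: lim_lin.
- by exists M.
- by move=> x Dx; apply: uniq => eps e0; exists x => //; rewrite !subrr normr0.
Qed.

(** Adjointness is tested on a dense set, one argument at a time. *)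
Lemma dotp_bounded_eq D A B : closure D = setT ->
  (exists M : R[i], forall x, `|A x| <= M * `|x|) ->
  (exists M : R[i], forall x, `|B x| <= M * `|x|) ->
  linear A -> linear B ->
  (forall x y, D x -> D y -> dotp (A x) y = dotp x (B y)) ->
  adjoint_of A B.
Proof.
move=> cD [M AM] [N BN] lA lB AB.
have half x y : D x -> dotp (A x) y = dotp x (B y).
  move=> Dx; apply/eqP; rewrite -subr_eq0; apply/eqP.
  apply: (@bounded_vanish _ V R[i]^o D (fun y => dotp (A x) y - dotp x (B y))
    (`|A x| + `|x| * `|N|)); last by rewrite cD.
  - move=> u v; rewrite !dotpBr (linear_mapB lB) dotpBr; ring.
  - move=> u; apply: le_trans (ler_normB _ _) _; rewrite mulrDl lerD //.
      exact: le_norm_dotp.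
    rewrite -mulrA; apply: le_trans (le_norm_dotp _ _) _.
    by rewrite ler_wpM2l // le_normM_of_le.
  - by move=> u Du; rewrite AB // subrr.
move=> x y; apply/eqP; rewrite -subr_eq0; apply/eqP.
apply: (@bounded_vanish _ V R[i]^o D (fun x => dotp (A x) y - dotp x (B y))
    (`|M| * `|y| + `|B y|)); last by rewrite cD.
- by move=> u v; rewrite !dotpBl (linear_mapB lA) dotpBl; ring.
- move=> u; apply: le_trans (ler_normB _ _) _; rewrite mulrDl lerD //.
    rewrite mulrAC; apply: le_trans (le_norm_dotp _ _) _.
    by rewrite ler_wpM2r // le_normM_of_le.
  by rewrite mulrC; exact: le_norm_dotp.
- by move=> u Du; rewrite half // subrr.
Qed.

End Extension.

(** * Vectors of the symmetric Fock space *)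

Section Permanent.
Context (K : comNzRingType).

(** The expansion of a permanent along its first row: permutations are sorted
    by the image [j] of the first index, and those with a given [j] are the
    [lift_perm ord0 j s]. The inner products of the symmetric Fock space are
    permanents, so this is the source of the annihilation formula. *)
Lemma permanent_expand_row n (A : 'I_n.+1 -> 'I_n.+1 -> K) :
  \sum_(s : 'S_n.+1) \prod_i A i (s i) =
  \sum_j A ord0 j *
    \sum_(s : 'S_n) \prod_i A (lift ord0 i) (lift j (s i)).
Proof.
rewrite (partition_big (fun s : 'S_n.+1 => s ord0) predT) //=.
apply: eq_bigr => j _; rewrite (reindex (lift_perm ord0 j)); last first.
  pose ulsf i (s : 'S_n.+1) k := odflt k (unlift (s i) (s (lift i k))).
  have ulsfK i (s : 'S_n.+1) k : lift (s i) (ulsf i s k) = s (lift i k).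
    rewrite /ulsf; have := neq_lift i k.
    by rewrite -(can_eq (permK s)) => /unlift_some[] ? ? ->.
  have inj_ulsf : injective (ulsf ord0 _).
    move=> s; apply: can_inj (ulsf (s ord0) s^-1%g) _ => k'.
    by rewrite {1}/ulsf ulsfK !permK liftK.
  exists (fun s => perm (inj_ulsf s)) => [s _|s /eqP s0].
    by apply/permP => k'; rewrite permE /ulsf lift_perm_lift lift_perm_id liftK.
  apply/permP => k; case: (unliftP ord0 k) => [k'|] ->.
    by rewrite lift_perm_lift -s0 permE ulsfK.
  by rewrite lift_perm_id s0.
rewrite big_distrr /=; apply: eq_big => [s|s _].
  by rewrite lift_perm_id eqxx.
rewrite big_ord_recl lift_perm_id; congr (_ * _).
by apply: eq_bigr => i _; rewrite lift_perm_lift.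
Qed.

End Permanent.

(** The breve in the formula for the annihilation operator. *)
Definition omit (T : Type) (j : nat) (s : seq T) := take j s ++ drop j.+1 s.

Section Omit.
Context (T : Type).
Implicit Types s : seq T.

Lemma size_omit j s : (j < size s)%N -> size (omit j s) = (size s).-1.
Proof.
move=> js; rewrite size_cat size_drop size_takel ?(ltnW js) //.
by rewrite -{2}(subnKC js).
Qed.

Lemma nth_omit x0 j s i : (j < size s)%N ->
  nth x0 (omit j s) i = nth x0 s (bump j i).
Proof.
move=> js; rewrite /omit nth_cat size_takel ?(ltnW js) // /bump.
case: ltnP => ij; first by rewrite nth_take.
by rewrite nth_drop addSn subnKC.
Qed.

Lemma map_omit (U : Type) (h : T -> U) j s : map h (omit j s) = omit j (map h s).
Proof. by rewrite /omit map_cat map_take map_drop. Qed.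

Lemma omit0 x s : omit 0 (x :: s) = s.
Proof. by rewrite /omit take0 /= drop0. Qed.

Lemma omitS x j s : omit j.+1 (x :: s) = x :: omit j s.
Proof. by []. Qed.

End Omit.

Section Fock.
Context (R : realType) (H F : hilbertType R) (sp : seq H -> F).
Hypothesis hsp : is_symmetric_Fock sp.
Implicit Types (u : H) (v w : seq H).

Lemma eq_of_dotp_sp (x y : F) :
  (forall w, dotp x (sp w) = dotp y (sp w)) -> x = y.
Proof.
by move=> xy; apply: (eq_of_dotp_total (proj2 hsp)) => _ [w _ <-].
Qed.

Lemma dotp_sp v w : size v = size w -> dotp (sp v) (sp w) =
  ((size w)`!%:R)^-1 *
    \sum_(s : 'S_(size w)) \prod_(i < size w) dotp v`_i w`_(s i).
Proof. by move=> vw; rewrite (proj1 hsp) vw eqxx. Qed.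

Lemma dotp_sp_neq v w : size v != size w -> dotp (sp v) (sp w) = 0.
Proof. by move=> vw; rewrite (proj1 hsp) (negPf vw). Qed.

Lemma dotp_sp_cons u v w :
  (size w)%:R * dotp (sp (u :: v)) (sp w) =
  \sum_(j < size w) dotp u w`_j * dotp (sp v) (sp (omit j w)).
Proof.
have [vw|vw] := eqVneq (size v).+1 (size w); last first.
  rewrite dotp_sp_neq // mulr0 big1 // => j _.
  rewrite dotp_sp_neq ?mulr0 // size_omit //; apply: contra vw => /eqP ->.
  by rewrite prednK // (leq_ltn_trans _ (ltn_ord j)).
rewrite dotp_sp // -vw.
rewrite (permanent_expand_row (fun i j : 'I_(size v).+1 => dotp (u :: v)`_i w`_j)).
rewrite factS natrM invfM mulrA mulVKf ?pnatr_eq0 //.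
rewrite mulr_sumr; apply: eq_bigr => j _; rewrite mulrCA; congr (_ * _).
have jw : (j < size w)%N by rewrite -vw.
have sw : size (omit j w) = size v by rewrite size_omit // -vw.
rewrite dotp_sp // sw; congr (_ * _); apply: eq_bigr => s _.
by apply: eq_bigr => i _; rewrite nth_omit.
Qed.

Definition creation_vec u v : F := sqrtC (size v).+1%:R *: sp (u :: v).

Definition annihilation_vec u v : F :=
  (sqrtC (size v)%:R)^-1 *: \sum_(j < size v) dotp u v`_j *: sp (omit j v).

(** The adjointness of creation and annihilation on product vectors, before
    either is known to define a linear operator. *)
Lemma creation_vec_adjoint u v w :
  dotp (creation_vec u v) (sp w) = dotp (sp v) (annihilation_vec u w).
Proof.
rewrite dotpZl dotpZr dotp_sumr.
under eq_bigr do rewrite dotpZr.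
rewrite -dotp_sp_cons conj_Creal ?ger0_real ?sqrtC_ge0 //.
have [<-|vw] := eqVneq (size v).+1 (size w); last by rewrite dotp_sp_neq ?mulr0.
rewrite mulrA; congr (_ * _).
rewrite -[X in _ * X]sqrtCK expr2 mulrA mulVf ?mul1r //.
by rewrite sqrtC_eq0 pnatr_eq0.
Qed.

(** A family with a formal adjoint respects every linear relation among the
    vectors [b t], since those vectors are total. *)
Lemma linear_extensionE (T : Type) (b b' b'' : T -> F) n (c : 'I_n -> R[i])
    (s : 'I_n -> T) :
  (forall x y : F, (forall r, dotp x (b r) = dotp y (b r)) -> x = y) ->
  (forall r q, dotp (b' r) (b q) = dotp (b r) (b'' q)) ->
  linear_extension b b' (\sum_(i < n) c i *: b (s i)) =
    \sum_(i < n) c i *: b' (s i).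
Proof.
move=> tot adj; rewrite /linear_extension.
case: xgetP => [y -> [p [d [r [E ->]]]]|].
  apply: tot => q; rewrite !dotp_suml.
  under eq_bigr do rewrite dotpZl adj -dotpZl.
  under [RHS]eq_bigr do rewrite dotpZl adj -dotpZl.
  by rewrite -!dotp_suml E.
move=> /(_ (\sum_(i < n) c i *: b' (s i))) []; by exists n, c, s.
Qed.

Lemma linear_extension_linear (T : Type) (b b' b'' : T -> F) :
  (forall x y : F, (forall r, dotp x (b r) = dotp y (b r)) -> x = y) ->
  (forall r q, dotp (b' r) (b q) = dotp (b r) (b'' q)) ->
  linear_on (lspan (range b)) (linear_extension b b') /\
  forall r, linear_extension b b' (b r) = b' r.
Proof.
move=> tot adj; split; last first.
  move=> r; have := linear_extensionE (fun=> 1) (fun _ : 'I_1 => r) tot adj.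
  by rewrite !big_ord1 !scale1r.
move=> a x y Lx Ly.
have val z : lspan (range b) z -> forall q,
    dotp (linear_extension b b' z) (b q) = dotp z (b'' q).
  move=> [n [c [s [Ss ->]]]] q.
  have /choice [r hr] : forall i, exists r, s i = b r.
    by move=> i; have [r _ <-] := Ss i; exists r.
  have {hr}-> : s = (fun i => b (r i)) by apply/funext.
  rewrite (linear_extensionE _ _ tot adj) !dotp_suml.
  by apply: eq_bigr => i _; rewrite !dotpZl adj.
apply: tot => q; rewrite dotpDl dotpZl !val //; last first.
  by case: (lspan_submodule (range b)) => _; apply.
by rewrite dotpDl dotpZl.
Qed.

Lemma creation_linear u : linear_on (lspan (range sp)) (creation sp u) /\
  forall v, creation sp u (sp v) = creation_vec u v.
Proof.
exact: (linear_extension_linear eq_of_dotp_sp (creation_vec_adjoint u)).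
Qed.

Lemma annihilation_linear u :
  linear_on (lspan (range sp)) (annihilation sp u) /\
  forall v, annihilation sp u (sp v) = annihilation_vec u v.
Proof.
apply: (linear_extension_linear (b'' := creation_vec u) eq_of_dotp_sp) => v w.
by rewrite dotpC -creation_vec_adjoint -dotpC.
Qed.

(** Permuting the factors permutes the rows of the permanents that give the
    inner products with all product vectors, and those are total. *)
Lemma sp_perm v w : perm_eq v w -> sp v = sp w.
Proof.
move=> vw; apply: eq_of_dotp_sp => z; have szvw := perm_size vw.
have [wz|wz] := eqVneq (size w) (size z); last by rewrite !dotp_sp_neq // szvw.
rewrite !dotp_sp ?szvw //; congr (_ * _).
have /tuple_permP [p vp] : perm_eq v (Tuple (introT eqP wz)) by [].
have nthv (i : 'I_(size z)) : v`_i = w`_(p i).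
  by rewrite vp (nth_map i) ?size_enum_ord // nth_ord_enum (tnth_nth 0).
rewrite (reindex_inj (mulgI p)) /=; apply: eq_bigr => s _.
rewrite [RHS](reindex_inj (@perm_inj _ p)) /=.
by apply: eq_bigr => i _; rewrite permM nthv.
Qed.

Lemma sp_cons_linear v : linear (fun u => sp (u :: v)).
Proof.
move=> a u u'; apply: eq_of_dotp_sp => w.
have [w0|w0] := eqVneq (size w) 0.
  by rewrite dotpDl dotpZl !dotp_sp_neq ?w0 // mulr0 addr0.
have wn : (size w)%:R != 0 :> R[i] by rewrite pnatr_eq0.
apply: (mulfI wn); rewrite dotpDl dotpZl mulrDr mulrCA !dotp_sp_cons.
rewrite mulr_sumr -big_split /=; apply: eq_bigr => j _.
by rewrite dotpDl dotpZl mulrDl mulrA.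
Qed.

(** Each of the n! terms of the permanent that gives the squared norm is at most
    the squared product of the norms. *)
Lemma norm_sp_le w : `|sp w| <= \prod_(i < size w) `|w`_i|.
Proof.
have p0 : 0 <= \prod_(i < size w) `|w`_i| by apply: prodr_ge0.
rewrite -(@ler_pXn2r _ 2) ?nnegrE // -dotpp dotp_sp //.
have fp : 0 < (size w)`!%:R :> R[i] by rewrite ltr0n fact_gt0.
set S := \sum_(_ | _) _; have S0 : 0 <= S.
  have -> : S = (size w)`!%:R * dotp (sp w) (sp w).
    by rewrite dotp_sp // mulrA mulfV ?mul1r // gt_eqF.
  by rewrite dotpp mulr_ge0 // ltW.
rewrite mulrC ler_pdivrMr // -[S]ger0_norm //.
apply: le_trans (ler_norm_sum _ _ _) _.
have -> : (\prod_(i < size w) `|w`_i|) ^+ 2 * (size w)`!%:R =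
    \sum_(s : 'S_(size w)) (\prod_(i < size w) `|w`_i|) ^+ 2.
  by rewrite sumr_const card_Sn mulr_natr.
apply: ler_sum => s _; rewrite normr_prod expr2.
rewrite [X in _ <= _ * X](reindex_inj (@perm_inj _ s)) -big_split /=.
by apply: ler_prod => i _; rewrite normr_ge0 le_norm_dotp.
Qed.

End Fock.

Section TensorBasis.
Context (R : realType) (G H F : hilbertType R).
Context (e : nat -> G) (he : orthonormal_basis e).
Context (t : L2C R -> G -> H) (ht : is_tensor_product t).
Implicit Types (f g : L2C R) (k : nat).

Lemma dotp_tensor_basis f g j k : (0 < j)%N -> (0 < k)%N ->
  dotp (t f (e j)) (t g (e k)) = L2dot f g * (j == k)%:R.
Proof. by move=> j0 k0; rewrite (proj1 ht) (proj1 he). Qed.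

(** The scalar product of L^2 is read off inside [H], so that its positivity
    comes from that of the norm of [H] and no integral is ever computed. *)
Lemma L2dot_tensor f g : L2dot f g = dotp (t f (e 1)) (t g (e 1)).
Proof. by rewrite dotp_tensor_basis // mulr1. Qed.

Lemma tensor_linear f : linear (t f).
Proof.
move=> a x y; apply: (eq_of_dotp_total (proj2 ht)) => _ [g [z ->]].
rewrite dotpDl dotpZl !(proj1 ht) dotpDl dotpZl; ring.
Qed.

Lemma norm_tensor f x : `|t f x| = `|t f (e 1)| * `|x|.
Proof.
have := proj1 ht f f x x; rewrite L2dot_tensor !dotpp -exprMn.
by move/eqP; rewrite eqrXn2 ?mulr_ge0 // => /eqP.
Qed.

Lemma tensor_basis_total :
  cspan [set u | exists f k, (0 < k)%N /\ u = t f (e k)] = setT.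
Proof.
set S := [set u | _].
have cS : closed (cspan S) by exact: closed_closure.
have sS : submodule (cspan S) by exact: cspan_submodule.
rewrite -subTset -(proj2 ht); apply: cspan_min => // _ [f [x ->]].
have nt := normr_ge0 (t f (e 1)).
apply: (total_preimage (proj2 he) (tensor_linear f) nt) => //.
  by move=> y; rewrite norm_tensor.
by move=> _ [k k0 <-]; apply: sub_cspan; exists f, k.
Qed.

End TensorBasis.

(** * Orthogonal projections *)

Section Projection.
Context (R : realType) (V : hilbertType R).
Implicit Types (S : set V) (x y z : V).

Lemma orth_cspan S x : (forall z, S z -> dotp z x = 0) ->
  forall z, cspan S z -> dotp z x = 0.
Proof.
move=> Sx z; apply: (@bounded_vanish _ V R[i]^o (lspan S)
  (fun z => dotp z x) (`|x|)).
- by move=> u v; rewrite dotpBl.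
- by move=> u; rewrite mulrC; exact: le_norm_dotp.
- apply: (lspan_ind (P := fun z => dotp z x = 0)); first by rewrite dotp0l.
  by move=> a u v Su uv; rewrite dotpDl dotpZl Sx // mulr0 add0r.
Qed.

(** A relation, because [orth_proj] is a projection only at the points [x] for
    which such a [y] exists. *)
Definition is_projection S x y :=
  cspan S y /\ forall z, S z -> dotp z (x - y) = 0.

Lemma orth_projE S x y : is_projection S x y -> orth_proj (cspan S) x = y.
Proof.
move=> [Sy xy]; rewrite /orth_proj.
case: xgetP => [y' _ [Sy' xy']|/(_ y) []]; last first.
  by split=> //; exact: orth_cspan.
apply/eqP; rewrite -subr_eq0; apply/eqP/dotpp_eq0.
have Syy : cspan S (y' - y) by exact: (submoduleB (cspan_submodule S) Sy' Sy).
have -> : dotp (y' - y) (y' - y) =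
    dotp (y' - y) (x - y) - dotp (y' - y) (x - y').
  by rewrite -dotpBr opprB [x - y + _]addrC addrA subrK.
by rewrite xy' // (orth_cspan xy) // subrr.
Qed.

Lemma is_projection_linear S a x y x' y' : is_projection S x x' ->
  is_projection S y y' -> is_projection S (a *: x + y) (a *: x' + y').
Proof.
move=> [Sx xo] [Sy yo]; split; first by case: (cspan_submodule S) => _; apply.
move=> z Sz; rewrite opprD addrACA -scalerBr dotpDr dotpZr xo // yo //.
by rewrite mulr0 addr0.
Qed.

Lemma is_projection_norm S x y : is_projection S x y -> `|y| <= `|x|.
Proof.
move=> [Sy xy]; apply: norm_le_of_sqr => //; rewrite -dotpp.
have yy : dotp y y = dotp y x.
  by apply/eqP; rewrite eq_sym -subr_eq0 -dotpBr (orth_cspan xy).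
rewrite yy mulrC; apply: le_trans (le_norm_dotp _ _).
by rewrite ger0_norm // -yy dotpp exprn_ge0.
Qed.

End Projection.

(** * The finite particle domain *)

(* Membership in lists of letters needs an equality test on L^2. *)
HB.instance Definition _ (R : realType) := gen_eqMixin (L2C R).

Section Kets.
Context (R : realType) (G H F : hilbertType R).
Context (e : nat -> G) (he : orthonormal_basis e).
Context (t : L2C R -> G -> H) (ht : is_tensor_product t).
Context (sp : seq H -> F) (hsp : is_symmetric_Fock sp).
Implicit Types (f g : L2C R) (s w : seq (L2C R * nat)).

Definition letters s : seq H := [seq t p.1 (e p.2) | p <- s].

Definition ket s : F := sp (letters s).

Definition positive s := all (fun p => 0 < p.2)%N s.

(** The empty list has level 0, one less than every index of the basis: the
    vacuum is thereby treated like the other product vectors. *)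
Definition level s := (\max_(p <- s) p.2)%N.

Definition kets : set F := [set x | exists2 s, positive s & x = ket s].

Lemma size_letters s : size (letters s) = size s.
Proof. exact: size_map. Qed.

Lemma positive_omit j s : positive s -> positive (omit j s).
Proof.
move=> /allP ps; apply/allP => p.
by rewrite mem_cat => /orP[/mem_take|/mem_drop]; exact: ps.
Qed.

Lemma le_level p s : p \in s -> (p.2 <= level s)%N.
Proof. by move=> ps; exact: leq_bigmax_seq. Qed.

Lemma level_cons p s : level (p :: s) = maxn p.2 (level s).
Proof. by rewrite /level big_cons. Qed.

Lemma level_ltP r s : (0 < r)%N ->
  reflect (forall p, p \in s -> (p.2 < r)%N) (level s < r)%N.
Proof.
case: r => // r _; apply: (iffP idP) => [lr p ps|lr].
  by apply: leq_ltn_trans lr; exact: le_level.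
by rewrite ltnS; apply/bigmax_leqP_seq => p ps _; exact: lr.
Qed.

Lemma ket_perm s w : perm_eq s w -> ket s = ket w.
Proof. by move=> sw; apply: (sp_perm hsp); exact: perm_map. Qed.

(** Symmetry of the Fock space makes the ordering of the indices in the
    definition of the domain immaterial. *)
Lemma finite_particleE : finite_particle e t sp = lspan kets.
Proof.
apply/seteqP; split; apply: (lspan_min (lspan_submodule _)) => x.
  by move=> [s [ps _ ->]]; apply: sub_lspan; exists s.
move=> [s ps ->]; apply: sub_lspan.
exists (sort (relpre snd leq) s); split.
- by rewrite /positive (perm_all _ (permEl (perm_sort _ _))).
- by rewrite sorted_map; apply: sort_sorted => p q; exact: leq_total.
- by apply: ket_perm; rewrite perm_sym perm_sort.
Qed.

Lemma kets_sub_range x : lspan kets x -> lspan (range sp) x.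
Proof.
apply: (lspan_min (lspan_submodule _)) => {}x [s _ ->]; apply: sub_lspan.
by exists (letters s).
Qed.

(** The vectors of a product may be replaced by basis tensors one at a time,
    as the product is linear and bounded in its first factor. *)
Lemma kets_dense : closure (lspan kets) = setT.
Proof.
rewrite -/(cspan kets).
have cK : closed (cspan kets) by exact: closed_closure.
have sK := cspan_submodule kets.
rewrite -subTset -(proj2 hsp); apply: cspan_min => // _ [us _ <-].
suff : forall s, positive s -> cspan kets (sp (us ++ letters s)).
  by move=> /(_ [::] isT); rewrite cats0.
elim: us => [|u us IH] s ps; first by apply: sub_cspan; exists s.
pose v := us ++ letters s; pose M := \prod_(i < size v) `|v`_i|.
have M0 : 0 <= M by apply: prodr_ge0.
have tot := tensor_basis_total he ht.
apply: (total_preimage tot (sp_cons_linear hsp v) M0) => //.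
  move=> y; apply: le_trans (norm_sp_le hsp _) _.
  by rewrite big_ord_recl mulrC.
move=> _ [f [k [k0 ->]]].
have -> : sp (t f (e k) :: v) = sp (us ++ letters ((f, k) :: s)).
  by apply: (sp_perm hsp); rewrite /v /= -cat1s perm_catCA.
by apply: IH; rewrite /= k0.
Qed.

Lemma in_one_particle r f k : (0 < k < r)%N -> one_particle e t r (t f (e k)).
Proof. by move=> kr; apply: sub_cspan; exists f, k. Qed.

Lemma one_particle_orth r u f k : one_particle e t r u -> (r <= k)%N ->
  dotp u (t f (e k)) = 0.
Proof.
move=> ur rk; apply: (orth_cspan _ ur) => _ [g [j [/andP[j0 jr] ->]]].
have jk : (j < k)%N by exact: leq_trans rk.
rewrite (dotp_tensor_basis he ht) ?(leq_trans j0 (ltnW jk)) //.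
by rewrite ltn_eqF // mulr0.
Qed.

(** A letter of index at least [r] is orthogonal to every one-particle vector
    below [r], so each product in the permanent has a vanishing factor. *)
Lemma sub_Fock_orth r us s : (0 < r)%N -> (r <= level s)%N ->
  (forall u, u \in us -> one_particle e t r u) -> dotp (sp us) (ket s) = 0.
Proof.
move=> r0 rs hus.
have [p ps rp] : exists2 p, p \in s & (r <= p.2)%N.
  apply: contrapT => np; move: rs; rewrite leqNgt => /level_ltP[] // p ps.
  by rewrite ltnNge; apply/negP => rp; apply: np; exists p.
have [ss|ss] := eqVneq (size us) (size (letters s)); last first.
  by rewrite (dotp_sp_neq hsp).
rewrite (dotp_sp hsp) // big1 ?mulr0 // => q _.
have js : (index p s < size (letters s))%N by rewrite size_letters index_mem.
(* The factor paired with the letter [p] of large index. *)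
rewrite (bigD1 (q^-1%g (Ordinal js))) //= permKV /=.
rewrite (nth_map p) ?index_mem // nth_index //.
rewrite (one_particle_orth _ _ rp) ?mul0r //.
by apply/hus/mem_nth; rewrite ss.
Qed.

Lemma ket_sub_Fock r s : positive s -> (level s < r)%N ->
  sub_Fock sp (one_particle e t r) (ket s).
Proof.
move=> ps lr; apply: sub_cspan; exists (letters s) => // u /mapP[p pin ->].
by apply: in_one_particle; rewrite (allP ps) // (leq_ltn_trans (le_level pin)).
Qed.

(** If the level of [s] is the smaller one, [ket s] lies in the Fock space below
    the level of [w], and [ket w] is orthogonal to that space. *)
Lemma ket_orth s w : positive s -> positive w -> level s != level w ->
  dotp (ket s) (ket w) = 0.
Proof.
wlog sw : s w / (level s < level w)%N.
  move=> hw ps pw sw; have [lt|lt|/eqP] := ltngtP (level s) (level w).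
  - exact: hw.
  - by apply: dotp_eq0C; apply: hw; rewrite // eq_sym.
  - by rewrite (negPf sw).
move=> ps pw _; apply: (@orth_cspan _ _ _ _ _ (ket s) (ket_sub_Fock ps sw)).
move=> _ [us hus <-]; apply: sub_Fock_orth (leqnn _) hus.
exact: leq_ltn_trans sw.
Qed.

Notation P := (proj_level e t sp).

Lemma is_projection_ket r s : positive s -> is_projection
  (sp @` [set us : seq H | forall u, u \in us -> one_particle e t r.+1 u])
  (ket s) (if (level s < r.+1)%N then ket s else 0).
Proof.
move=> ps; case: ltnP => lr; split.
- exact: ket_sub_Fock.
- by move=> z _; rewrite subrr dotp0r.
- by case: (cspan_submodule (sp @` [set us : seq H |
    forall u, u \in us -> one_particle e t r.+1 u])).
- by move=> _ [us hus <-]; rewrite subr0; exact: sub_Fock_orth lr hus.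
Qed.

Lemma proj_level_ket r s : positive s ->
  P (Some r) (ket s) = if (level s < r)%N then ket s else 0.
Proof. by case: r => // r ps; apply/orth_projE/is_projection_ket. Qed.

Lemma is_projection_kets r x : lspan kets x -> is_projection
  (sp @` [set us : seq H | forall u, u \in us -> one_particle e t r.+1 u])
  x (P (Some r.+1) x).
Proof.
set S := sp @` _ => Kx.
have [y xy] : exists y, is_projection S x y; last by rewrite /P (orth_projE xy).
move: x Kx; apply: lspan_ind.
  exists 0; split; last by move=> z _; rewrite subrr dotp0r.
  by case: (cspan_submodule S).
move=> a x y [s ps ->] [y' yy'].
exists (a *: (if (level s < r.+1)%N then ket s else 0) + y').
by apply: is_projection_linear => //; exact: is_projection_ket.
Qed.

Lemma proj_level_linear_on m : linear_on (lspan kets) (P m).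
Proof.
case: m => [[|r]|] a x y Kx Ky //=; first by rewrite scaler0 addr0.
by apply/orth_projE/is_projection_linear; exact: is_projection_kets.
Qed.

Lemma proj_level_kets m x : lspan kets x -> lspan kets (P m x).
Proof.
apply: linear_on_image (proj_level_linear_on m) _ x; first exact: lspan_submodule.
move=> _ [s ps ->]; case: m => [r|] /=; last by apply: sub_lspan; exists s.
rewrite -/(P (Some r)) proj_level_ket //; case: ifP => _.
  by apply: sub_lspan; exists s.
by case: (lspan_submodule kets).
Qed.

Lemma proj_level_norm m x : lspan kets x -> `|P m x| <= `|x|.
Proof.
case: m => [[|r]|] Kx //=; first by rewrite normr0.
exact: is_projection_norm (is_projection_kets r Kx).
Qed.

(** Off the finite particle domain the projection is obtained as the bounded
    extension of its restriction to that domain: both conditions that define a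
    projection are closed. *)
Lemma proj_level_bounded m : linear (P m) /\ forall x, `|P m x| <= 1 * `|x|.
Proof.
case: m => [[|r]|]; last 1 first.
- by split=> // x; rewrite mul1r.
- by split=> [a x y|x] /=; rewrite ?scaler0 ?addr0 // normr0 mul1r.
have PM x : lspan kets x -> `|P (Some r.+1) x| <= 1 * `|x|.
  by move=> Kx; rewrite mul1r; exact: proj_level_norm.
have [A [[lA _ AP] AM]] := bounded_extension_exists (lspan_submodule kets)
  kets_dense (proj_level_linear_on (Some r.+1)) ler01 PM.
suff -> : P (Some r.+1) = A by [].
apply/funext => x; apply: orth_projE.
set S := sp @` _.
have Kx : closure (lspan kets) x by rewrite kets_dense.
split.
  have cS : closed (cspan S) by exact: closed_closure.
  apply: (closed_preimage lA ler01 AM cS).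
  apply: closure_subset Kx => y Ky /=; rewrite AP //.
  exact: (proj1 (is_projection_kets r Ky)).
move=> z Sz.
apply: (@bounded_vanish _ F R[i]^o (lspan kets) (fun x => dotp z (x - A x))
  (`|z| * 2) _ _ _ x Kx).
- by move=> u v; rewrite -dotpBr (linear_mapB lA) opprD addrACA -opprD.
- move=> u; apply: le_trans (le_norm_dotp _ _) _; rewrite -mulrA ler_wpM2l //.
  apply: le_trans (ler_normB _ _) _; rewrite mulrDl mul1r lerD2l.
  by rewrite -[leRHS]mul1r.
- by move=> y Ky; rewrite AP //; exact: (proj2 (is_projection_kets r Ky)).
Qed.

End Kets.

(** * Free creation and annihilation operators *)

Section Limits.
Context (R : realType) (V : hilbertType R).

(** For infinite [m] the partial sums of the defining series are stationary on
    each product vector, hence on each vector of their span. *)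
Lemma linear_on_stationary (S : set V) (T : nat -> V -> V) :
  (forall n, linear_on (lspan S) (T n)) ->
  (forall x, S x -> exists N, forall n, (N <= n)%N -> T n x = T N x) ->
  forall x, lspan S x -> exists N, forall n, (N <= n)%N -> T n x = T N x.
Proof.
move=> lT sT x Sx; have sS := lspan_submodule S.
suff : lspan S x /\ exists N, forall n, (N <= n)%N -> T n x = T N x by case.
move: x Sx; apply: lspan_ind.
  by split; [case: sS | exists 0%N => n _; rewrite !(linear_on0 sS)].
move=> a x y Sx [Sy [N yN]]; have Lx := sub_lspan Sx.
split; first by case: sS => _; apply.
have [M xM] := sT x Sx; exists (maxn M N) => n; rewrite geq_max => /andP[Mn Nn].
by rewrite !lT // xM // yN // [in RHS]xM ?leq_maxl // [in RHS]yN ?leq_maxr.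
Qed.

Lemma limn_stationary (u : nat -> V) N :
  (forall n, (N <= n)%N -> u n = u N) -> limn u = u N.
Proof.
move=> uN; apply: lim_near_cst => //.
by near=> n; apply: uN; near: n; exact: nbhs_infty_ge.
Unshelve. all: by end_near. Qed.

Lemma linear_on_limn (S : set V) (T : nat -> V -> V) :
  (forall n, linear_on (lspan S) (T n)) ->
  (forall x, S x -> exists N, forall n, (N <= n)%N -> T n x = T N x) ->
  linear_on (lspan S) (fun x => limn (T ^~ x)).
Proof.
move=> lT sT a x y Sx Sy; have st := linear_on_stationary lT sT.
have [N xN] := st _ Sx; have [M yM] := st _ Sy.
rewrite (limn_stationary xN) (limn_stationary yM).
have aN n : (maxn N M <= n)%N -> T n (a *: x + y) = a *: T N x + T M y.
  by rewrite geq_max => /andP[Nn Mn]; rewrite lT // xN // yM.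
have aL n : (maxn N M <= n)%N -> T n (a *: x + y) = T (maxn N M) (a *: x + y).
  by move=> Nn; rewrite !aN.
by rewrite (limn_stationary aL) aN.
Qed.

Lemma dotp_lspan_adjoint (S : set V) (A B : V -> V) :
  linear_on (lspan S) A -> linear_on (lspan S) B ->
  (forall x y, S x -> S y -> dotp (A x) y = dotp x (B y)) ->
  forall x y, lspan S x -> lspan S y -> dotp (A x) y = dotp x (B y).
Proof.
move=> lA lB AB x y Sx Sy; have sS := lspan_submodule S.
have half u : S u -> dotp (A u) y = dotp u (B y).
  move=> Su; suff : lspan S y /\ dotp (A u) y = dotp u (B y) by case.
  move: y Sy; apply: lspan_ind.
    by split; [case: sS | rewrite (linear_on0 sS) // !dotp0r].
  move=> a v w Sv [Sw E]; have Lv := sub_lspan Sv.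
  split; first by case: sS => _; apply.
  by rewrite lB // !dotpDr !dotpZr E AB.
suff : lspan S x /\ dotp (A x) y = dotp x (B y) by case.
move: x Sx; apply: lspan_ind.
  by split; [case: sS | rewrite (linear_on0 sS) // !dotp0l].
move=> a v w Sv [Sw E]; have Lv := sub_lspan Sv.
split; first by case: sS => _; apply.
by rewrite lA // !dotpDl !dotpZl E half.
Qed.

End Limits.

Section FreeOperators.
Context (R : realType) (G H F : hilbertType R).
Context (e : nat -> G) (he : orthonormal_basis e).
Context (t : L2C R -> G -> H) (ht : is_tensor_product t).
Context (sp : seq H -> F) (hsp : is_symmetric_Fock sp).
Implicit Types (f g : L2C R) (s w : seq (L2C R * nat)).
Implicit Types (m : option nat).

Local Notation P := (proj_level e t sp).
Local Notation kets := (kets e t sp).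
Local Notation ket := (ket e t sp).
Local Notation letters := (letters e t).
Local Notation D := (lspan kets).
Local Notation l_star := (free_creation e t sp).
Local Notation l_ := (free_annihilation e t sp).

Let sD : submodule D := lspan_submodule kets.

(** The levels that the projection P^(m) retains. *)
Definition below m k := if m is Some n then (k < n)%N else true.

Lemma proj_level_below m s : positive s ->
  P m (ket s) = if below m (level s) then ket s else 0.
Proof. by case: m => // r ps; exact: (proj_level_ket he ht hsp r). Qed.

Lemma ket_in s : positive s -> D (ket s).
Proof. by move=> ps; apply: sub_lspan; exists s. Qed.

Lemma creation_ket u s : creation sp u (ket s) = creation_vec sp u (letters s).
Proof. exact: (proj2 (creation_linear hsp u)). Qed.

Lemma annihilation_ket u s :
  annihilation sp u (ket s) = (sqrtC (size s)%:R)^-1 *: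
    \sum_(j < size s) dotp u (letters s)`_j *: ket (omit j s).
Proof.
rewrite (proj2 (annihilation_linear hsp u)) /annihilation_vec size_letters.
by congr (_ *: _); apply: eq_bigr => j _; rewrite /ket /letters map_omit.
Qed.

Lemma annihilation_kets u x : D x -> D (annihilation sp u x).
Proof.
have lA : linear_on D (annihilation sp u).
  move=> a y z Dy Dz; apply: (proj1 (annihilation_linear hsp u)).
    exact: (kets_sub_range Dy).
  exact: (kets_sub_range Dz).
apply: (linear_on_image sD lA) => _ [s ps ->]; rewrite annihilation_ket.
apply: (submoduleZ _ sD); apply: (submodule_sum sD) => j _.
by apply: (submoduleZ _ sD); apply/ket_in/positive_omit.
Qed.

Lemma creation_level_linear k u : linear_on D (creation_level e t sp k u).
Proof.
move=> a x y Dx Dy; rewrite /creation_level (proj_level_linear_on he ht hsp) //.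
have Px := proj_level_kets he ht hsp (Some k).
apply: (proj1 (creation_linear hsp u)).
  exact: (kets_sub_range (Px _ Dx)).
exact: (kets_sub_range (Px _ Dy)).
Qed.

Lemma annihilation_level_linear k u :
  linear_on D (annihilation_level e t sp k u).
Proof.
move=> a x y Dx Dy; rewrite /annihilation_level.
rewrite (proj1 (annihilation_linear hsp u)); last 2 first.
- exact: (kets_sub_range Dx).
- exact: (kets_sub_range Dy).
by apply: (proj_level_linear_on he ht hsp); exact: annihilation_kets.
Qed.

Lemma linear_on_sumB (I : Type) (r : seq I) (A B : I -> F -> F) :
  (forall i, linear_on D (A i)) -> (forall i, linear_on D (B i)) ->
  linear_on D (fun x => \sum_(i <- r) (A i x - B i x)).
Proof.
move=> lA lB a x y Dx Dy; rewrite scaler_sumr -big_split /=.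
by apply: eq_bigr => i _; rewrite lA // lB // scalerBr opprD addrACA.
Qed.

(** The difference of consecutive projections keeps exactly the product vectors
    of level k - 1, so a single term of the sum survives: the one that creates
    the index next to the level. *)
Lemma creation_ketE n f s : positive s -> l_star (Some n) f (ket s) =
  if (level s < n)%N
  then creation_vec sp (t f (e (level s).+1)) (letters s) else 0.
Proof.
move=> ps; rewrite /free_creation.
have c0 u : creation sp u 0 = 0.
  rewrite (linear_on0 (lspan_submodule (range sp))) //.
  exact: (proj1 (creation_linear hsp u)).
transitivity (\sum_(1 <= k < n.+1 | k == (level s).+1)
    creation_vec sp (t f (e k)) (letters s)); last by rewrite big_nat1_eq ltnS.
rewrite [RHS]big_mkcond; apply: eq_big_nat => k /andP[k1 _].
rewrite /creation_level !(proj_level_ket he ht hsp _ ps).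
case: k k1 => // k _; rewrite ltnS /= eqSS eq_sym.
case: ltngtP => sk; rewrite ?ltnS ?creation_ket ?c0 ?subr0 ?subrr //.
Qed.

Definition creation_image m f s : F :=
  if below m (level s)
  then creation_vec sp (t f (e (level s).+1)) (letters s) else 0.

(** A letter is removed only if its index is one above the maximum of the
    others; the inner product with the basis vector of that index enforces
    this. *)
Definition annihilation_image m f w : F :=
  (sqrtC (size w)%:R)^-1 *: \sum_(j < size w)
    (if below m (level (omit j w))
     then dotp (t f (e (level (omit j w)).+1)) (letters w)`_j else 0) *:
    ket (omit j w).

(** For each position [j] only the term whose index exceeds by one the level of
    the remaining letters survives the differences of projections. *)
Lemma annihilation_ketE n f s : positive s ->
  l_ (Some n) f (ket s) = annihilation_image (Some n) f s.
Proof.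
move=> ps; rewrite /free_annihilation /annihilation_level.
transitivity (\sum_(1 <= k < n.+1) (sqrtC (size s)%:R)^-1 *:
  \sum_(j < size s) if k == (level (omit j s)).+1 then
    dotp (t f (e k)) (letters s)`_j *: ket (omit j s) else 0).
  apply: eq_big_nat => k /andP[k1 _]; rewrite annihilation_ket.
  have Do j : D (ket (omit j s)) by apply/ket_in/positive_omit.
  have lP r := proj_level_linear_on he ht hsp (Some r).
  have Ds : D (\sum_(j < size s)
      dotp (t f (e k)) (letters s)`_j *: ket (omit j s)).
    by apply: (submodule_sum sD) => j _; exact: (submoduleZ _ sD).
  rewrite !(linear_onZ _ sD (lP _)) // !(linear_on_sum _ sD (lP _)) //.
  rewrite {Ds} -scalerBr -sumrB; congr (_ *: _); apply: eq_bigr => j _.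
  rewrite !(proj_level_ket he ht hsp _ (positive_omit j ps)) -scalerBr.
  case: k k1 => // k _; rewrite ltnS /= eqSS eq_sym.
  by case: ltngtP => sk; rewrite ?subr0 ?subrr ?scaler0.
rewrite -scaler_sumr exchange_big /=; congr (_ *: _); apply: eq_bigr => j _.
rewrite -big_mkcond big_nat1_eq /= ltnS; case: ifP => // _.
by rewrite scale0r.
Qed.

(** The partial sums on [ket s] are constant once they pass [level s], which
    gives the case of infinite [m]. *)
Lemma free_creation_on m f : linear_on D (l_star m f) /\
  forall s, positive s -> l_star m f (ket s) = creation_image m f s.
Proof.
have lin n : linear_on D (l_star (Some n) f).
  by apply: linear_on_sumB => k; exact: creation_level_linear.
case: m => [n|]; first by split=> // s; exact: creation_ketE.
have st s : positive s -> forall n, ((level s).+1 <= n)%N ->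
    l_star (Some n) f (ket s) = l_star (Some (level s).+1) f (ket s).
  by move=> ps n sn; rewrite !creation_ketE // sn ltnS leqnn.
split.
  apply: (linear_on_limn lin) => _ [s ps ->].
  by exists (level s).+1 => n; exact: st.
move=> s ps; rewrite [LHS](limn_stationary (st s ps)) creation_ketE //.
by rewrite ltnS leqnn.
Qed.

Lemma level_omit j s : (level (omit j s) <= level s)%N.
Proof.
apply/bigmax_leqP_seq => p; rewrite mem_cat => /orP[/mem_take|/mem_drop] ps _;
  exact: le_level.
Qed.

Lemma free_annihilation_on m f : linear_on D (l_ m f) /\
  forall s, positive s -> l_ m f (ket s) = annihilation_image m f s.
Proof.
have lin n : linear_on D (l_ (Some n) f).
  by apply: linear_on_sumB => k; exact: annihilation_level_linear.
case: m => [n|]; first by split=> // s; exact: annihilation_ketE.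
have st s : positive s -> forall n, ((level s).+1 <= n)%N ->
    l_ (Some n) f (ket s) = annihilation_image None f s.
  move=> ps n sn; rewrite annihilation_ketE //; congr (_ *: _).
  apply: eq_bigr => j _; rewrite /below.
  by rewrite (leq_ltn_trans (level_omit j s) sn).
have st' s : positive s -> forall n, ((level s).+1 <= n)%N ->
    l_ (Some n) f (ket s) = l_ (Some (level s).+1) f (ket s).
  by move=> ps n sn; rewrite !st.
split.
  apply: (linear_on_limn lin) => _ [s ps ->].
  by exists (level s).+1 => n; exact: st'.
by move=> s ps; rewrite [LHS](limn_stationary (st' s ps)) st.
Qed.

Lemma free_creation_in m f x : D x -> D (l_star m f x).
Proof.
apply: (linear_on_image sD (proj1 (free_creation_on m f))) => _ [s ps ->].
rewrite (proj2 (free_creation_on m f)) // /creation_image.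
case: ifP => _; last by case: sD.
apply: (submoduleZ _ sD); rewrite -/(letters ((f, (level s).+1) :: s)).
exact: (@ket_in ((f, (level s).+1) :: s)).
Qed.

Lemma free_annihilation_in m f x : D x -> D (l_ m f x).
Proof.
apply: (linear_on_image sD (proj1 (free_annihilation_on m f))) => _ [s ps ->].
rewrite (proj2 (free_annihilation_on m f)) //.
apply: (submoduleZ _ sD); apply: (submodule_sum sD) => j _.
by apply: (submoduleZ _ sD); apply/ket_in/positive_omit.
Qed.

(** The boson operators are adjoint term by term; the conditions on the levels
    differ on the two sides only where the two remaining product vectors are
    orthogonal. *)
Lemma free_adjoint_on m f x y : D x -> D y ->
  dotp (l_star m f x) y = dotp x (l_ m f y).
Proof.
have [lA Ak] := free_creation_on m f; have [lB Bk] := free_annihilation_on m f.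
move: x y; apply: (dotp_lspan_adjoint lA lB) => _ _ [s ps ->] [w pw ->].
rewrite Ak // Bk // dotpZr dotp_sumr.
have -> : dotp (creation_image m f s) (ket w) = if below m (level s) then
    dotp (ket s) (annihilation sp (t f (e (level s).+1)) (ket w)) else 0.
  rewrite /creation_image; case: ifP => _; last by rewrite dotp0l.
  by rewrite (creation_vec_adjoint hsp) (proj2 (annihilation_linear hsp _)).
transitivity ((sqrtC (size w)%:R)^-1 * \sum_(j < size w)
  if below m (level s) then dotp (t f (e (level s).+1)) (letters w)`_j *
    dotp (ket s) (ket (omit j w)) else 0).
  case: ifP => _; last by rewrite big1 // mulr0.
  rewrite annihilation_ket dotpZr dotp_sumr; congr (_ * _).
  by apply: eq_bigr => j _; rewrite dotpZr.
congr (_ * _); apply: eq_bigr => j _; rewrite dotpZr.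
have [->|sw] := eqVneq (level s) (level (omit j w)).
  by case: ifP => _; rewrite ?mul0r.
by rewrite (ket_orth he ht hsp ps (positive_omit j pw) sw) !mulr0 if_same.
Qed.

(** The created letter has the index L + 1, where L is the level of [s]. Its
    removal restores [ket s] with the factor <g, f>, the roots from creation and
    annihilation cancelling. After removal of any other letter the level is
    still L + 1, which calls for a letter of index L + 2, and there is none. *)
Lemma free_relation_on m f g x : D x ->
  l_ m g (l_star m f x) = L2dot g f *: P m x.
Proof.
have [lA Ak] := free_creation_on m f; have [lB Bk] := free_annihilation_on m g.
move: x; apply: (linear_on_eq (T := fun x => l_ m g (l_star m f x))
  (A := fun x => L2dot g f *: P m x)).
- move=> a y z Dy Dz; rewrite lA // lB //; exact: free_creation_in.
- move=> a y z Dy Dz; rewrite (proj_level_linear_on he ht hsp) //.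
  by rewrite scalerDr !scalerA mulrC.
move=> _ [s ps ->]; rewrite Ak // proj_level_below // /creation_image.
case: ifP => mb; last by rewrite (linear_on0 sD lB) scaler0.
set L := level s; pose w := (f, L.+1) :: s.
have pw : positive w by [].
have -> : creation_vec sp (t f (e L.+1)) (letters s) =
    sqrtC (size s).+1%:R *: ket w by rewrite /creation_vec size_letters.
rewrite (linear_onZ _ sD lB (ket_in pw)).
rewrite Bk // /annihilation_image /= scalerA.
rewrite mulfV ?sqrtC_eq0 ?pnatr_eq0 // scale1r.
rewrite big_ord_recl big1 => [|j _]; last first.
  rewrite /= /bump /= add1n omitS level_cons /=.
  have js : (j < size s)%N by [].
  rewrite (nth_map (f, 0%N)) //.
  rewrite (dotp_tensor_basis he ht) //; last exact: (allP ps _ (mem_nth _ js)).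
  rewrite gtn_eqF ?mulr0 ?if_same ?scale0r //.
  by rewrite ltnS (leq_trans (le_level (mem_nth _ js))) // leq_max leqW.
rewrite addr0 omit0 mb /= (dotp_tensor_basis he ht) // eqxx mulr1.
by [].
Qed.

(** The relation on the domain turns the squared norm of [l_star m f x] into
    <f, f> times the inner product of [x] with its projection. *)
Lemma norm_free_creation m f x : D x -> `|l_star m f x| <= `|t f (e 1)| * `|x|.
Proof.
move=> Dx; rewrite -(@ler_pXn2r _ 2) ?nnegrE ?mulr_ge0 // -dotpp.
have E := free_adjoint_on m f Dx (free_creation_in m f Dx).
rewrite -[X in X <= _]ger0_norm ?dotpp ?exprn_ge0 // -dotpp E.
rewrite free_relation_on // dotpZr (L2dot_tensor he ht) dotpp normrM.
rewrite normrX normr_id exprMn ler_wpM2l ?exprn_ge0 //.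
apply: le_trans (le_norm_dotp _ _) _; rewrite expr2 ler_wpM2l //.
exact: (proj_level_norm he ht hsp).
Qed.

Lemma norm_free_annihilation m f x : D x -> `|l_ m f x| <= `|t f (e 1)| * `|x|.
Proof.
move=> Dx; apply: norm_le_of_sqr; rewrite ?mulr_ge0 //.
have Dy := free_annihilation_in m f Dx.
rewrite -dotpp -(free_adjoint_on m f Dy Dx).
have -> : dotp (l_star m f (l_ m f x)) x = `|dotp (l_star m f (l_ m f x)) x|.
  by rewrite ger0_norm // free_adjoint_on // dotpp exprn_ge0.
apply: le_trans (le_norm_dotp _ _) _; rewrite mulrAC ler_wpM2r //.
exact: norm_free_creation.
Qed.

End FreeOperators.

Theorem theorem9p3 (R : realType) (G H F : hilbertType R)
    (e : nat -> G) (he : orthonormal_basis e)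
    (t : L2C R -> G -> H) (ht : is_tensor_product t)
    (sp : seq H -> F) (hsp : is_symmetric_Fock sp)
    (m : option nat) (hm : m <> Some 0%N) (f g : L2C R) :
  [/\ exists! A : F -> F,
        bounded_extension (finite_particle e t sp)
          (free_creation e t sp m f) A,
      exists! B : F -> F,
        bounded_extension (finite_particle e t sp)
          (free_annihilation e t sp m f) B,
      forall A B : F -> F,
        bounded_extension (finite_particle e t sp)
          (free_creation e t sp m f) A ->
        bounded_extension (finite_particle e t sp)
          (free_annihilation e t sp m f) B ->
        adjoint_of A B &
      forall A B : F -> F,
        bounded_extension (finite_particle e t sp)
          (free_creation e t sp m f) A ->
        bounded_extension (finite_particle e t sp)
          (free_annihilation e t sp m g) B ->
        forall x, B (A x) = L2dot g f *: proj_level e t sp m x].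
Proof.
rewrite (finite_particleE e t hsp).
have sK := lspan_submodule (kets e t sp); have cK := kets_dense he ht hsp.
have ext_unique T : linear_on (lspan (kets e t sp)) T ->
    (forall x, lspan (kets e t sp) x -> `|T x| <= `|t f (e 1)| * `|x|) ->
    exists! A, bounded_extension (lspan (kets e t sp)) T A.
  move=> lT TM; have [A [hA _]] :=
    bounded_extension_exists sK cK lT (normr_ge0 _) TM.
  by exists A; split=> // A'; exact: bounded_extension_eq.
split.
- apply: ext_unique; first exact: (proj1 (free_creation_on he ht hsp m f)).
  by move=> x; exact: norm_free_creation.
- apply: ext_unique; first exact: (proj1 (free_annihilation_on he ht hsp m f)).
  by move=> x; exact: norm_free_annihilation.
- move=> A B [lA bA AT] [lB bB BT]; apply: dotp_bounded_eq cK bA bB lA lB _.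
  by move=> x y Dx Dy; rewrite AT // BT //; exact: free_adjoint_on.
- move=> A B [lA [M AM] AT] [lB [N BN] BT].
  have [lP PM] := proj_level_bounded he ht hsp m.
  pose c := L2dot g f; pose T x := c *: proj_level e t sp m x.
  suff : B \o A = T by move=> E x; rewrite -/(T x) -E.
  apply: (bounded_extension_eq (T := T) sK cK); split=> //.
  + by move=> a x y; rewrite /= lA lB.
  + exists (`|N| * `|M|) => x; rewrite -mulrA.
    apply: le_trans (le_normM_of_le _ _ (BN _)) _ => //.
    by rewrite ler_wpM2l // le_normM_of_le.
  + move=> x Dx; rewrite /= AT // BT; last exact: free_creation_in.
    exact: free_relation_on.
  + by move=> a x y; rewrite /T lP scalerDr !scalerA mulrC.
  + exists `|c| => x; rewrite normrZ ler_wpM2l //.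
    by have := PM x; rewrite mul1r.
Qed.
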